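(* Let $\tau^0$ be a non-empty generalized pattern with no hyphens, let $\phi$ be an arbitrary partially ordered generalized pattern, and let $\tau=\tau^0\mbox{-}\phi$, where the letters of $\tau^0$ are incomparable to the letters of $\phi$. Then for all $k\ge1$, $$A_\tau(x;k)=A_{\tau^0}(x;k)+A_\phi(x;k)\,A^*_{\tau^0}(x;k).$$
   Context: $[k]^n$ = words of length $n$ over $\{1,\dots,k\}$. A generalized pattern with no hyphens is a word over $[m]$ using every letter of $[m]$. A partially ordered generalized pattern (POGP) has letters from a partially ordered set, possibly with hyphens between consecutive letters; a word $\sigma$ contains a POGP $\pi=\pi_1\cdots\pi_r$ if there are indices $i_1<\dots<i_r$ with $i_{j+1}=i_j+1$ whenever $\pi_j,\pi_{j+1}$ are not separated by a hyphen, and for every pair of positions whose letters are comparable (identical letters are equal) the corresponding letters of $\sigma$ stand in the same relation ($<,=,>$); incomparable pairs are unconstrained. Otherwise $\sigma$ avoids $\pi$. $\tau^0\mbox{-}\phi$ denotes the concatenation of $\tau^0$ and $\phi$ separated by a hyphen. $A_\pi(x;k)=\sum_{n\ge0}a_\pi(n;k)x^n$, $a_\pi(n;k)$ the number of words in $[k]^n$ avoiding $\pi$. A word quasi-avoids a hyphen-free pattern $\rho$ of length $m$ if it has exactly one occurrence of $\rho$ and that occurrence consists of its $m$ rightmost letters; $A^*_\rho(x;k)=\sum_{n\ge0}a^*_\rho(n;k)x^n$ with $a^*_\rho(n;k)$ the number of words in $[k]^n$ quasi-avoiding $\rho$. *)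

(* Defs.v *)
From HB Require Import structures.
From mathcomp Require Import all_boot all_order all_algebra.

Set Implicit Arguments.
Unset Strict Implicit.
Unset Printing Implicit Defensive.

Import Order.TTheory GRing.Theory.

(* A partially ordered generalized pattern. Positions are numbered from 0;    *)
(* phyph j says that a hyphen separates the letters at positions j and j.+1   *)
(* (only the values with j.+1 < size pword are meaningful).                   *)
Record pogp (d : Order.disp_t) (P : porderType d) := Pogp {
  pword : seq P;
  phyph : pred nat
}.

Definition plen (d : Order.disp_t) (P : porderType d) (pi : pogp P) : nat :=
  size (pword pi).

Definition pletter (d : Order.disp_t) (P : porderType d) (pi : pogp P)
  (a : 'I_(plen pi)) : P := tnth (in_tuple (pword pi)) a.

Definition no_hyphen (d : Order.disp_t) (P : porderType d) (w : seq P) :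
  pogp P := Pogp w pred0.

Definition hyphen_cat (d : Order.disp_t) (P : porderType d) (pi phi : pogp P) :
  pogp P :=
  Pogp (pword pi ++ pword phi)
    (fun j => if j.+1 < plen pi then phyph pi j
              else if j.+1 == plen pi then true
              else phyph phi (j - plen pi)).

(* i sends each position of the pattern to a position of the word. The case   *)
(* of a pair with letters related by > is that of the swapped pair.           *)
Definition occurrence (d : Order.disp_t) (P : porderType d) (pi : pogp P)
  (k n : nat) (s : n.-tuple 'I_k) (i : {ffun 'I_(plen pi) -> 'I_n}) : bool :=
  [forall a : 'I_(plen pi), forall b : 'I_(plen pi),
    [&& (a < b) ==> (i a < i b),
        ((b == a.+1 :> nat) && ~~ phyph pi a) ==> (i b == (i a).+1 :> nat),
        (pletter a < pletter b)%O ==> (tnth s (i a) < tnth s (i b)) &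
        (pletter a == pletter b) ==> (tnth s (i a) == tnth s (i b))]].

Definition occurrences (d : Order.disp_t) (P : porderType d) (pi : pogp P)
  (k n : nat) (s : n.-tuple 'I_k) : {set {ffun 'I_(plen pi) -> 'I_n}} :=
  [set i | occurrence s i].

Definition contains (d : Order.disp_t) (P : porderType d) (pi : pogp P)
  (k n : nat) (s : n.-tuple 'I_k) : bool :=
  [exists i : {ffun 'I_(plen pi) -> 'I_n}, occurrence s i].

Definition avoids (d : Order.disp_t) (P : porderType d) (pi : pogp P)
  (k n : nat) (s : n.-tuple 'I_k) : bool := ~~ contains pi s.

(* The a-th letter of the occurrence is at position n - plen pi + a; the      *)
(* equation is rearranged to avoid truncated subtraction.                     *)
Definition rightmost (d : Order.disp_t) (P : porderType d) (pi : pogp P)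
  (n : nat) (i : {ffun 'I_(plen pi) -> 'I_n}) : bool :=
  [forall a : 'I_(plen pi), i a + plen pi == n + a].

(* Meant for hyphen-free pi.                                                  *)
Definition quasi_avoids (d : Order.disp_t) (P : porderType d) (pi : pogp P)
  (k n : nat) (s : n.-tuple 'I_k) : bool :=
  (#|occurrences pi s| == 1) && [forall i in occurrences pi s, rightmost i].

Definition num_avoid (d : Order.disp_t) (P : porderType d) (pi : pogp P)
  (k n : nat) : nat := #|[set s : n.-tuple 'I_k | avoids pi s]|.

Definition num_quasi_avoid (d : Order.disp_t) (P : porderType d) (pi : pogp P)
  (k n : nat) : nat := #|[set s : n.-tuple 'I_k | quasi_avoids pi s]|.

(* Formal power series in one variable, as sequences of coefficients.         *)
Definition fps := nat -> int.

Definition fps_add (f g : fps) : fps := fun n => (f n + g n)%R.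

Definition fps_mul (f g : fps) : fps :=
  fun n => (\sum_(i < n.+1) f i * g (n - i)%N)%R.

Definition A_gf (d : Order.disp_t) (P : porderType d) (pi : pogp P) (k : nat) :
  fps := fun n => Posz (num_avoid pi k n).

Definition Astar_gf (d : Order.disp_t) (P : porderType d) (pi : pogp P)
  (k : nat) : fps := fun n => Posz (num_quasi_avoid pi k n).

(* Main.v *)
Require Import Defs.
From HB Require Import structures.
From mathcomp Require Import all_boot all_order all_algebra zify.

(** If [w] contains [tau0], let [q] be the end of its leftmost occurrence.
    Then [take q w] quasi-avoids [tau0], no other prefix of [w] does, and since
    the letters of [tau0] and [phi] are incomparable, [w] avoids [tau0-phi] if
    and only if [drop q w] avoids [phi]. Hence, for every word [w] of length
    [n], the indicator of "[w] avoids [tau0-phi]" is the indicator of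
    "[w] avoids [tau0]" plus the sum over [i <= n] of the indicators of
    "[drop (n - i) w] avoids [phi] and [take (n - i) w] quasi-avoids [tau0]";
    summing over [w] gives the identity between coefficients. *)

Set Implicit Arguments.
Unset Strict Implicit.
Unset Printing Implicit Defensive.

Import Order.TTheory.

(** * Occurrences as functions on natural numbers *)

(** Words are sequences over [nat] and positions are plain numbers, so that cutting a word or
    shifting an occurrence changes no type. The values of [i] beyond the pattern do not matter. *)
Definition occurs_via (d : Order.disp_t) (P : porderType d) (x0 : P)
    (pi : pogp P) (w : seq nat) (i : nat -> nat) : Prop :=
  forall a b, a < plen pi -> b < plen pi ->
    [/\ i a < size w,
        a < b -> i a < i b,
        b = a.+1 -> ~~ phyph pi a -> i b = (i a).+1,
        (nth x0 (pword pi) a < nth x0 (pword pi) b)%O ->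
          nth 0 w (i a) < nth 0 w (i b) &
        nth x0 (pword pi) a = nth x0 (pword pi) b ->
          nth 0 w (i a) = nth 0 w (i b)].

(** A hyphen-free occurrence is determined by its start [p]. The test is boolean so that a least
    such [p] can be taken. *)
Definition match_at (d : Order.disp_t) (P : porderType d) (t : seq P)
    (w : seq nat) (p : nat) : bool :=
  (p + size t <= size w) &&
  [forall a : 'I_(size t), forall b : 'I_(size t),
    ((tnth (in_tuple t) a < tnth (in_tuple t) b)%O ==>
       (nth 0 w (p + a) < nth 0 w (p + b))) &&
    ((tnth (in_tuple t) a == tnth (in_tuple t) b) ==>
       (nth 0 w (p + a) == nth 0 w (p + b)))].

Section Occurrences.

Variables (d : Order.disp_t) (P : porderType d) (x0 : P).
Implicit Types (pi : pogp P) (t : seq P) (w : seq nat).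

Lemma match_atP t w p :
  reflect
    (p + size t <= size w /\
     forall a b, a < size t -> b < size t ->
       ((nth x0 t a < nth x0 t b)%O -> nth 0 w (p + a) < nth 0 w (p + b)) /\
       (nth x0 t a = nth x0 t b -> nth 0 w (p + a) = nth 0 w (p + b)))
    (match_at t w p).
Proof.
apply: (iffP andP) => -[le_pw H]; split=> //.
  move=> a b lt_a lt_b.
  have /forallP/(_ (Ordinal lt_b))/andP[] := forallP H (Ordinal lt_a).
  rewrite !(tnth_nth x0) /= => /implyP H1 /implyP H2; split=> // e.
  by apply/eqP/H2/eqP.
apply/forallP => a; apply/forallP => b.
have [H1 H2] := H a b (ltn_ord a) (ltn_ord b).
rewrite !(tnth_nth x0) /=; apply/andP; split; apply/implyP => //.
by move/eqP/H2/eqP.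
Qed.

Lemma occurrenceP pi k n (s : n.-tuple 'I_k) (i : {ffun 'I_(plen pi) -> 'I_n})
    (j : nat -> nat) :
  (forall a : 'I_(plen pi), j a = i a) ->
  reflect (occurs_via x0 pi (map val s) j) (occurrence s i).
Proof.
move=> ji.
have nthE a : nth 0 (map val s) (i a) = tnth s (i a).
  by rewrite -[LHS](tnth_nth 0 (map_tuple val s)) tnth_map.
apply: (iffP forallP) => H.
  move=> a b lt_a lt_b.
  have /forallP/(_ (Ordinal lt_b)) := H (Ordinal lt_a).
  rewrite /pletter !(tnth_nth x0) /=.
  have := ji (Ordinal lt_a); have := ji (Ordinal lt_b); move=> /= -> ->.
  case/and4P=> /implyP H1 /implyP H2 /implyP H3 /implyP H4.
  rewrite size_map size_tuple !nthE; split=> //.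
  - by move=> e nh; apply/eqP/H2; rewrite e eqxx.
  - by move=> e; congr (val _); apply/eqP/H4/eqP.
move=> a; apply/forallP => b.
have [_ H1 H2 H3 H4] := H a b (ltn_ord a) (ltn_ord b).
rewrite /pletter !(tnth_nth x0) /=.
move: H1 H2 H3 H4; rewrite !ji !nthE => H1 H2 H3 H4.
apply/and4P; split; apply/implyP => //.
- by case/andP=> /eqP e nh; apply/eqP/H2.
- by move/eqP/H4 => e; apply/eqP/val_inj.
Qed.

Lemma occurrence_of_fun pi k n (s : n.-tuple 'I_k) (j : nat -> nat) :
  occurs_via x0 pi (map val s) j ->
  exists2 i : {ffun 'I_(plen pi) -> 'I_n},
    occurrence s i & forall a : 'I_(plen pi), j a = i a.
Proof.
move=> H.
have lt_j (a : 'I_(plen pi)) : j a < n.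
  by have [] := H a a (ltn_ord a) (ltn_ord a); rewrite size_map size_tuple.
pose i : {ffun 'I_(plen pi) -> 'I_n} := [ffun a => Ordinal (lt_j a)].
have ji (a : 'I_(plen pi)) : j a = i a by rewrite ffunE.
by exists i => //; apply/(occurrenceP _ ji).
Qed.

Lemma fun_of_occurrence pi k n (s : n.-tuple 'I_k)
    (i : {ffun 'I_(plen pi) -> 'I_n}) :
  occurrence s i ->
  exists2 j, occurs_via x0 pi (map val s) j &
    forall a : 'I_(plen pi), j a = i a.
Proof.
move=> si.
(* Extend [i] by 0 outside the pattern. *)
pose j a := oapp (fun b : 'I_(plen pi) => val (i b)) 0 (insub a).
have ji (a : 'I_(plen pi)) : j a = i a by rewrite /j valK.
by exists j => //; apply/(occurrenceP s ji).
Qed.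

Lemma containsP pi k n (s : n.-tuple 'I_k) :
  reflect (exists j, occurs_via x0 pi (map val s) j) (contains pi s).
Proof.
apply: (iffP existsP) => [[i /fun_of_occurrence[j sj _]]|[j]].
  by exists j.
by case/occurrence_of_fun=> i si _; exists i.
Qed.

(** The shorter suffix starts at offset [q - q'] of the longer one, so positions shift by that
    amount. *)
Lemma occurs_via_drop_le pi w q q' j :
  q' <= q -> occurs_via x0 pi (drop q w) j ->
  occurs_via x0 pi (drop q' w) (fun a => q - q' + j a).
Proof.
move=> le_q H a b lt_a lt_b; have [H1 H2 H3 H4 H5] := H a b lt_a lt_b.
move: H1 H4 H5; rewrite !nth_drop !size_drop !addnA !(addnC q') !subnK //.
move=> H1 H4 H5; split=> //; first by lia.
- by move/H2; lia.
- by move=> e /H3 -> //; lia.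
Qed.

(** * Contiguous matches of hyphen-free patterns *)

Lemma match_at_take t w q p :
  q <= size w ->
  match_at t (take q w) p = match_at t w p && (p + size t <= q).
Proof.
move=> le_q; apply/match_atP/andP.
  rewrite size_takel // => -[le_p H]; split=> //.
  apply/match_atP; split; first by lia.
  move=> a b lt_a lt_b; have := H a b lt_a lt_b.
  by rewrite !nth_take //; lia.
case=> /match_atP[_ H] le_p; rewrite size_takel //; split=> //.
move=> a b lt_a lt_b; have := H a b lt_a lt_b.
by rewrite !nth_take //; lia.
Qed.

Lemma occurs_via_no_hyphen t w j :
  occurs_via x0 (no_hyphen t) w j -> forall a, a < size t -> j a = j 0 + a.
Proof.
move=> H; elim=> [|a IHa] lt_a; first by rewrite addn0.
have [|_ _ H3 _ _] := H a a.+1 _ lt_a; first exact: ltnW.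
by rewrite H3 // IHa 1?ltnW // addnS.
Qed.

Lemma match_at_of_occurs_via t w j :
  0 < size t -> occurs_via x0 (no_hyphen t) w j -> match_at t w (j 0).
Proof.
move=> t_gt0 H; apply/match_atP; split.
  have lt_p : (size t).-1 < size t by rewrite prednK.
  have [+ _ _ _ _] := H _ _ lt_p lt_p.
  by rewrite (occurs_via_no_hyphen H) //; lia.
move=> a b lt_a lt_b; have [_ _ _] := H a b lt_a lt_b.
by rewrite (occurs_via_no_hyphen H lt_a) (occurs_via_no_hyphen H lt_b).
Qed.

Lemma occurs_via_match_at t w p :
  match_at t w p -> occurs_via x0 (no_hyphen t) w (addn p).
Proof.
case/match_atP=> le_p H a b; rewrite /plen /= => lt_a lt_b.
have [H1 H2] := H a b lt_a lt_b.
by split=> //; lia.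
Qed.

Lemma contains_no_hyphenP t k n (s : n.-tuple 'I_k) :
  0 < size t ->
  reflect (exists p, match_at t (map val s) p) (contains (no_hyphen t) s).
Proof.
move=> t_gt0; apply: (iffP (containsP _ _)) => [[j H]|[p H]].
  by exists (j 0); exact: match_at_of_occurs_via.
by exists (addn p); exact: occurs_via_match_at.
Qed.

(** Matches that end at the same place start at the same place, so uniqueness follows once every
    match is known to end at [n]. *)
Lemma quasi_avoidsP t k n (s : n.-tuple 'I_k) :
  0 < size t ->
  reflect ((exists p, match_at t (map val s) p) /\
           forall p, match_at t (map val s) p -> p + size t = n)
          (quasi_avoids (no_hyphen t) s).
Proof.
move=> t_gt0; pose z : 'I_(plen (no_hyphen t)) := Ordinal t_gt0.
apply: (iffP andP) => [[/cards1P[i0 def_i0] /forall_inP rm]|[[p tp] uniq_p]].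
  split=> [|p /occurs_via_match_at/occurrence_of_fun[i si ip]].
    have : i0 \in occurrences (no_hyphen t) s by rewrite def_i0 set11.
    rewrite inE => /fun_of_occurrence[j H _].
    by exists (j 0); exact: match_at_of_occurs_via.
  have /forallP/(_ z) := rm i ltac:(by rewrite inE).
  by rewrite -ip /= !addn0 => /eqP.
have occE i : i \in occurrences (no_hyphen t) s ->
    forall a, i a + size t = n + a :> nat.
  rewrite inE => /fun_of_occurrence[j H ji] a.
  have := uniq_p _ (match_at_of_occurs_via t_gt0 H).
  by rewrite -ji (occurs_via_no_hyphen H (ltn_ord a)); lia.
split; last first.
  by apply/forall_inP => i /occE E; apply/forallP => a; apply/eqP/E.
have [i0 s_i0 _] := occurrence_of_fun (occurs_via_match_at tp).
have i0_in : i0 \in occurrences (no_hyphen t) s by rewrite inE.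
apply/cards1P; exists i0; apply/setP => i; rewrite in_set1.
apply/idP/eqP => [i_in|-> //].
apply/ffunP => a; apply/val_inj/eqP.
by rewrite -(eqn_add2r (size t)) (occE _ i_in) (occE _ i0_in).
Qed.

(** * Occurrences of the hyphenated concatenation *)

(** Incomparability removes every constraint on values between the two blocks, and the hyphen
    removes adjacency. All that remains is that [phi] occurs after the end of the match of [t]. *)
Lemma contains_hyphen_catP t phi k n (s : n.-tuple 'I_k) :
  0 < size t ->
  (forall x y, x \in t -> y \in pword phi -> (x >< y)%O) ->
  reflect (exists2 p, match_at t (map val s) p &
             exists j, occurs_via x0 phi (drop (p + size t) (map val s)) j)
          (contains (hyphen_cat (no_hyphen t) phi) s).
Proof.
move=> t_gt0 incomp; set w := map val s.
have nthl a : a < size t -> nth x0 (t ++ pword phi) a = nth x0 t a.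
  by rewrite nth_cat => ->.
have nthr a : nth x0 (t ++ pword phi) (size t + a) = nth x0 (pword phi) a.
  by rewrite nth_cat ltnNge leq_addr addKn.
have plenE : plen (hyphen_cat (no_hyphen t) phi) = size t + plen phi.
  by rewrite /plen size_cat.
apply: (iffP (containsP _ _)) => [[i]|[p tp [j H]]]; rewrite -/w.
  move=> H.
  have tH : occurs_via x0 (no_hyphen t) w i.
    move=> a b; rewrite /plen /= => lt_a lt_b.
    have [||H1 H2 H3] := H a b; rewrite ?plenE; try lia.
    rewrite /= !nthl // => H4 H5; split=> // e _; apply: H3 => //=.
    by rewrite /plen /= -e lt_b.
  have tp := match_at_of_occurs_via t_gt0 tH; exists (i 0) => //.
  have iE := occurs_via_no_hyphen tH.
  (* Compare with the last letter of [t], at position [i 0 + size t - 1]. *)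
  have ge_i a : a < plen phi -> i 0 + size t <= i (size t + a).
    move=> lt_a; have [||_ + _ _ _] := H (size t).-1 (size t + a).
    - by rewrite plenE; lia.
    - by rewrite plenE; lia.
    by rewrite iE; lia.
  exists (fun a => i (size t + a) - (i 0 + size t)) => a b lt_a lt_b.
  have [||H1 H2 H3] := H (size t + a) (size t + b).
  - by rewrite plenE; lia.
  - by rewrite plenE; lia.
  rewrite /= !nthr => H4 H5.
  have ge_a := ge_i a lt_a; have ge_b := ge_i b lt_b.
  rewrite size_drop !nth_drop !subnKC //; split=> //.
  - by lia.
  - by move=> lt_ab; have := H2 ltac:(lia); lia.
  - move=> e nh; rewrite H3; first by lia.
      by rewrite e addnS.
    rewrite /= /plen /= ifF; last by lia.
    by rewrite ifF ?addKn //; lia.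
exists (fun a => if a < size t then p + a else p + size t + j (a - size t)).
have tH := occurs_via_match_at tp.
have le_p : p + size t <= size w by case/match_atP: tp.
(* Makes the clauses on values vacuous for mixed pairs. *)
have nlt x y : x \in t -> y \in pword phi -> [/\ (x < y)%O = false,
    (y < x)%O = false, x <> y & y <> x].
  move=> xt yphi; have xy := incomp x y xt yphi.
  split; [exact: incomparable_ltF | | move=> e | move=> e].
  - by rewrite incomparable_ltF // comparable_sym.
  - by rewrite e comparablexx in xy.
  - by rewrite e comparablexx in xy.
move=> a b; rewrite plenE => lt_a lt_b.
case: (ltnP a (size t)) => le_a; case: (ltnP b (size t)) => le_b.
- have [H1 H2 H3 H4 H5] := tH a b le_a le_b.
  rewrite /= !nthl //; split=> // e _.
  by rewrite e addnS.
- have lt_b' : b - size t < plen phi by lia.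
  have [H1 _ _ _ _] := H _ _ lt_b' lt_b'.
  rewrite size_drop in H1.
  have nb : nth x0 (pword phi) (b - size t) \in pword phi by apply: mem_nth.
  have [F1 F2 F3 F4] := nlt _ _ (mem_nth x0 le_a) nb.
  have nb' := nthr (b - size t); rewrite subnKC // in nb'.
  rewrite /= nthl // nb' F1; split=> //.
  + by lia.
  + by lia.
  (* Here [a] is the last position of [t], which is followed by the hyphen. *)
  + move=> e; rewrite /plen /= ifF; last by lia.
    by rewrite ifT //; lia.
- have lt_a' : a - size t < plen phi by lia.
  have [H1 _ _ _ _] := H _ _ lt_a' lt_a'.
  rewrite size_drop in H1.
  have na : nth x0 (pword phi) (a - size t) \in pword phi by apply: mem_nth.
  have [F1 F2 F3 F4] := nlt _ _ (mem_nth x0 le_b) na.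
  have na' := nthr (a - size t); rewrite subnKC // in na'.
  rewrite /= (nthl b) // na' F2; split=> //; lia.
have lt_a' : a - size t < plen phi by lia.
have lt_b' : b - size t < plen phi by lia.
have [H1 H2 H3 H4 H5] := H _ _ lt_a' lt_b'.
rewrite size_drop in H1; rewrite !nth_drop in H4 H5.
have na := nthr (a - size t); have nb := nthr (b - size t).
rewrite !subnKC // in na nb; rewrite /= na nb; split=> //.
- by lia.
- by move=> lt_ab; have := H2 ltac:(lia); lia.
- move=> e; rewrite /plen /= ifF; last by lia.
  rewrite ifF; last by lia.
  by move=> nh; rewrite H3 ?addnS //; lia.
Qed.

End Occurrences.

(** * Embedded patterns, and sums over words *)

Lemma match_at_map (d1 d2 : Order.disp_t) (P1 : porderType d1)
    (P2 : porderType d2) (f : P1 -> P2) (x1 : P1) t w p :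
  {mono f : x y / (x <= y)%O} ->
  match_at (map f t) w p = match_at t w p.
Proof.
move=> f_mono; have f_inj := inc_inj f_mono.
apply/(match_atP (f x1))/(match_atP x1); rewrite size_map => -[le_p H];
  split=> // a b lt_a lt_b; have := H a b lt_a lt_b;
  rewrite !(nth_map x1) // (leW_mono f_mono) => -[H1 H2]; split=> // e.
- by apply: H2; rewrite e.
- exact/H2/f_inj.
Qed.

(** Replaces a predicate on tuples by one on the underlying sequences, which also applies to the
    results of [take] and [drop]. *)
Lemma tuple_eq_in_tuple (T : Type) (F : forall n, n.-tuple T -> bool) n
    (s : n.-tuple T) : F n s = F (size s) (in_tuple s).
Proof.
case: s => w sz_w /=; move: (sz_w); rewrite -(eqP sz_w) => sz_w'.
by congr (F _ _); apply: val_inj.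
Qed.

(** Cutting at [m] is a bijection between words of length [n] and pairs of words of lengths [m] and
    [n - m]; the double sum then factors. *)
Lemma sum_tuple_take_drop (T : finType) (F G : seq T -> nat) (n m : nat) :
  m <= n ->
  \sum_(s : n.-tuple T) F (take m s) * G (drop m s) =
  (\sum_(s : m.-tuple T) F s) * (\sum_(s : (n - m).-tuple T) G s).
Proof.
move=> le_mn; have nE : n = m + (n - m) by rewrite subnKC.
move: (n - m) nE => r ->.
rewrite big_distrlr /= pair_big /=.
pose h (u : m.-tuple T * r.-tuple T) := cat_tuple u.1 u.2.
have h_inj : injective h.
  case=> u1 u2 [v1 v2] /(congr1 val) /= /eqP.
  rewrite eqseq_cat ?size_tuple // => /andP[/eqP e1 /eqP e2].
  by congr (_, _); apply: val_inj.
have h_bij : bijective h.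
  (* Concatenation is injective between finite sets of equal size. *)
  by apply: inj_card_bij h_inj _; rewrite card_prod !card_tuple expnD.
rewrite (reindex h (onW_bij _ h_bij)) /=; apply: eq_bigr => -[u v] _ /=.
by rewrite take_size_cat ?drop_size_cat ?size_tuple.
Qed.

Lemma card_tuple_sum (T : finType) (F : forall n, n.-tuple T -> bool) n :
  #|[set s : n.-tuple T | F n s]| =
  \sum_(s : n.-tuple T) F _ (in_tuple s).
Proof.
rewrite -sum1_card big_mkcond; apply: eq_bigr => s _.
by rewrite inE -tuple_eq_in_tuple; case: (F n s).
Qed.

(** * The identity for a single word *)

(** The index [i] is the length of the suffix, to agree with the convolution in [fps_mul], whose
    first factor counts words avoiding [phi]. *)
Lemma avoids_hyphen_cat_indicator (d0 d : Order.disp_t) (P0 : porderType d0)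
    (P : porderType d) (x0 : P0) (emb : P0 -> P) (t : seq P0) (phi : pogp P)
    (k n : nat) (w : seq 'I_k) :
  size w = n ->
  0 < size t ->
  {mono emb : x y / (x <= y)%O} ->
  (forall x y, x \in t -> y \in pword phi -> (emb x >< y)%O) ->
  avoids (hyphen_cat (no_hyphen (map emb t)) phi) (in_tuple w) =
  avoids (no_hyphen t) (in_tuple w) +
  \sum_(i < n.+1)
    quasi_avoids (no_hyphen t) (in_tuple (take (n - i) w)) *
    avoids phi (in_tuple (drop (n - i) w)) :> nat.
Proof.
move=> size_w t_gt0 emb_mono incomp.
have et_gt0 : 0 < size (map emb t) by rewrite size_map.
have einc x y : x \in map emb t -> y \in pword phi -> (x >< y)%O.
  by case/mapP=> x' x't -> yphi; exact: incomp.
have catP := contains_hyphen_catP (emb x0) (in_tuple w) et_gt0 einc.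
have matchE p : match_at (map emb t) (map val w) p = match_at t (map val w) p.
  exact: match_at_map.
have sz_w : size (map val w) = n by rewrite size_map.
have mtake q p : q <= n -> match_at t (map val (take q w)) p =
    match_at t (map val w) p && (p + size t <= q).
  by move=> le_q; rewrite map_take (match_at_take x0) ?sz_w.
rewrite {2}/avoids.
case: (contains_no_hyphenP x0 (in_tuple w) t_gt0) => /= [ex_p|no_p]; last first.
  (* Without a match of [t] no prefix quasi-avoids it, and the concatenation cannot occur. *)
  rewrite big1 => [|i _].
    rewrite /avoids; case: catP => // -[p]; rewrite matchE => tp.
    by case: no_p; exists p.
  case: (quasi_avoidsP x0 _ t_gt0) => //= -[[p]].
  by rewrite mtake ?leq_subr // => /andP[tp _]; case: no_p; exists p.
have [p tp min_p] := ex_minnP ex_p.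
have le_q : p + size t <= n by case/(match_atP x0): tp; rewrite sz_w.
have lt_i0 : n - (p + size t) < n.+1 by rewrite ltnS leq_subr.
(* If the prefix has a match, it also contains the leftmost one, which must then end at [q].
   Conversely, in the prefix of length [p + size t] a match starts at most at [p] by length and at
   least at [p] by minimality. *)
have quasiE q : q <= n ->
    quasi_avoids (no_hyphen t) (in_tuple (take q w)) = (q == p + size t).
  move=> le_qn; apply/(quasi_avoidsP x0 _ t_gt0)/eqP => /=.
    case=> -[p']; rewrite mtake // => /andP[tp' le_p'].
    rewrite size_takel ?size_w // => H; rewrite -(H p) // mtake // tp /=.
    by have := min_p _ tp'; lia.
  move=> e; split; first by exists p; rewrite mtake // tp e leqnn.
  move=> p'; rewrite size_takel ?size_w // mtake // => /andP[tp' le_p'].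
  by have := min_p _ tp'; lia.
(* Only the cut at the end of the leftmost match contributes. *)
rewrite add0n (bigD1 (Ordinal lt_i0)) //= big1 => [|i ne_i].
  rewrite addn0 subKn // quasiE // eqxx mul1n /avoids; congr (~~ _ : nat).
  apply/catP/(containsP (emb x0)) => /=.
    case=> p'; rewrite matchE size_map => tp' [j H].
    (* An occurrence of [phi] after any match lies after the leftmost one too. *)
    rewrite map_drop; exists (fun a => p' + size t - (p + size t) + j a).
    by apply: occurs_via_drop_le H; rewrite leq_add2r min_p.
  by rewrite map_drop => H; exists p; rewrite ?matchE ?size_map.
rewrite quasiE ?leq_subr //; case: eqP => // e.
by case/eqP: ne_i; apply: val_inj => /=; have := ltn_ord i; lia.
Qed.

(** * Summation over all words of length [n] *)

Theorem mainTheorem10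
  (m : nat) (tau0 : seq 'I_m)
  (tau0_nonempty : tau0 != [::])
  (tau0_onto : forall c : 'I_m, c \in tau0)
  (d : Order.disp_t) (P : porderType d)
  (emb : 'I_m -> P)
  (emb_mono : {mono emb : x y / (x <= y)%O})
  (phi : pogp P)
  (incomp : forall (x : 'I_m) (y : P),
     x \in tau0 -> y \in pword phi -> (emb x >< y)%O)
  (k : nat) (k_ge1 : 1 <= k) :
  A_gf (hyphen_cat (no_hyphen (map emb tau0)) phi) k
  =1 fps_add (A_gf (no_hyphen tau0) k)
             (fps_mul (A_gf phi k) (Astar_gf (no_hyphen tau0) k)).
Proof.
move=> n; rewrite /fps_add /fps_mul /A_gf /Astar_gf.
have t_gt0 : 0 < size tau0 by rewrite lt0n size_eq0.
have x0 : 'I_m by case: (tau0) tau0_nonempty.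
under eq_bigr do rewrite -PoszM.
rewrite -(big_morph Posz PoszD (erefl (Posz 0))) -PoszD; congr Posz.
rewrite /num_avoid /num_quasi_avoid.
rewrite !(card_tuple_sum (fun n s => avoids _ s)).
under [LHS]eq_bigr => s _ do
  rewrite (avoids_hyphen_cat_indicator x0 (size_tuple s) t_gt0 emb_mono incomp).
rewrite big_split /=; congr (_ + _).
(* For fixed [i], the sum over words factors by cutting at [n - i]. *)
rewrite exchange_big /=; apply: eq_bigr => i _.
rewrite (sum_tuple_take_drop
  (fun w => quasi_avoids (no_hyphen tau0) (in_tuple w))
  (fun w => avoids phi (in_tuple w))) ?leq_subr //.
rewrite subKn; last by rewrite -ltnS ltn_ord.
by rewrite (card_tuple_sum (fun n s => avoids _ s))
           (card_tuple_sum (fun n s => quasi_avoids _ s)) mulnC.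
Qed.
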